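(* For all $a,b\in\mathbb{C}$, $$\mathrm{CDer}(CSV(a,b))=\mathrm{CInn}(CSV(a,b))\oplus\delta_{a,1}\mathbb{C}^\infty ,$$ where $\mathbb{C}^\infty$ stands for the space of conformal derivations $D_{\vec a}$, $\vec a\in\mathbb{C}^\infty$, of $CSV(1,b)$ (so the second summand is this space if $a=1$ and is $0$ if $a\neq1$).
   Context: A Lie conformal algebra is a $\mathbb{C}[\partial]$-module $R$ with a $\mathbb{C}$-linear map ($\lambda$-bracket) $R\otimes R\to R[\lambda]=\mathbb{C}[\lambda]\otimes R$, $x\otimes y\mapsto[x{}_\lambda y]$, satisfying $[\partial x{}_\lambda y]=-\lambda[x{}_\lambda y]$, $[x{}_\lambda\partial y]=(\partial+\lambda)[x{}_\lambda y]$, $[x{}_\lambda y]=-[y{}_{-\lambda-\partial}x]$ and $[x{}_\lambda[y{}_\mu z]]=[[x{}_\lambda y]{}_{\lambda+\mu}z]+[y{}_\mu[x{}_\lambda z]]$. For $a,b\in\mathbb{C}$, $CSV(a,b)$ is the Lie conformal algebra that is free over $\mathbb{C}[\partial]$ with basis $\{L_i,M_i,Y_i\mid i\in\mathbb{Z}\}$ and $\lambda$-brackets $$[L_i{}_\lambda L_j]=(\partial+2\lambda)L_{i+j},\quad [L_i{}_\lambda M_j]=(\partial+a\lambda+b)M_{i+j},\quad [L_i{}_\lambda Y_j]=\big(\partial+(\tfrac a2+1)\lambda+\tfrac b2\big)Y_{i+j},\quad [Y_i{}_\lambda Y_j]=(\partial+2\lambda)M_{i+j},$$ with $[M_i{}_\lambda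 L_j]$, $[Y_i{}_\lambda L_j]$ determined by skew-symmetry and all other brackets of generators zero. A conformal derivation of a Lie conformal algebra $R$ is a linear map $D=D_\lambda:R\to R[\lambda]$ such that for all $x,y\in R$, $D_\lambda(\partial x)=(\partial+\lambda)D_\lambda(x)$ and $D_\lambda([x{}_\mu y])=[(D_\lambda x){}_{\lambda+\mu}y]+[x{}_\mu(D_\lambda y)]$. For $x\in R$, $(\mathrm{ad}_x)_\lambda y=[x{}_\lambda y]$ defines a conformal derivation $\mathrm{ad}_x$; derivations of this kind are called inner. $\mathrm{CDer}(R)$ and $\mathrm{CInn}(R)$ denote the vector spaces of all conformal derivations and of all inner conformal derivations of $R$. $\mathbb{C}^\infty=\{\vec a=(a_c)_{c\in\mathbb{Z}}\mid a_c\in\mathbb{C},\ a_c=0\text{ for all but finitely many }c\}$. For $\vec a\in\mathbb{C}^\infty$, $D_{\vec a}$ is the conformal derivation of $CSV(1,b)$ determined by $(D_{\vec a})_\lambda(L_i)=\sum_{c\in\mathbb{Z}}a_cM_{i+c}$ and $(D_{\vec a})_\lambda(M_i)=(D_{\vec a})_\lambda(Y_i)=0$ for $i\in\mathbb{Z}$. The space of these derivations is also denoted $\mathbb{C}^\infty$. $\delta_{a,1}$ is the Kronecker delta. *)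

(* Defs.v *)
From HB Require Import structures.
From mathcomp Require Import all_boot all_order all_algebra.
From mathcomp Require Import finmap monalg complex classical_sets reals ring.

Set Implicit Arguments.
Unset Strict Implicit.
Unset Printing Implicit Defensive.

Import GRing.Theory.
Local Open Scope ring_scope.

(* V[lambda], as a module over A[lambda]: if V is a C[d]-module, V[lambda] is a
   module over C[d][lambda] = {poly {poly C}}, and V[lambda][mu] = lpoly (lpoly V)
   one over C[d][lambda][mu]. *)
Definition lpoly (A : nzRingType) (V : lmodType A) : Type := {malg V[nat]}.

Section Lpoly.
Context {A : nzRingType} {V : lmodType A}.

HB.instance Definition _ := GRing.Zmodule.on (lpoly V).

Definition lpolyZ (p : {poly A}) (v : lpoly V) : lpoly V :=
  \sum_(n <- msupp v) \sum_(i < size p) << p`_i *: v@_n *g (i + n)%N >>.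

Lemma lpolyZw (p : {poly A}) (v : lpoly V) (d : {fset nat}) m :
  (msupp v `<=` d)%fset -> (size p <= m)%N ->
  lpolyZ p v = \sum_(n <- d) \sum_(i < m) << p`_i *: v@_n *g (i + n)%N >>.
Proof.
move=> le_d le_m; rewrite /lpolyZ (big_fset_incl _ le_d) /=; last first.
  by move=> n _ /mcoeff_outdom ->; rewrite big1 // => i _; rewrite scaler0 monalgU0.
apply: eq_bigr => n _; rewrite (big_ord_widen m (fun i => << p`_i *: v@_n *g (i + n)%N >>) le_m).
rewrite [RHS](bigID (fun i : 'I_m => (i < size p)%N)) /= [X in _ + X]big1 ?addr0 //.
by move=> i; rewrite -leqNgt => le_p; rewrite nth_default // scale0r monalgU0.
Qed.

Lemma lpolyZDl v : {morph lpolyZ^~ v : p q / p + q}.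
Proof.
move=> p q; pose m := (maxn (size p) (size q)).
have ss := fsubset_refl (msupp v).
rewrite !(@lpolyZw _ v _ m ss) ?leq_maxl ?leq_maxr //; last exact: size_polyD.
rewrite -big_split; apply: eq_bigr => n _; rewrite -big_split; apply: eq_bigr => i _.
by rewrite coefD scalerDl monalgUD.
Qed.

Lemma lpolyZDr p : {morph lpolyZ p : u v / u + v}.
Proof.
move=> u v; rewrite (lpolyZw (msuppD_le u v) (leqnn _)).
rewrite (lpolyZw (fsubsetUl _ (msupp v)) (leqnn _)) (lpolyZw (fsubsetUr (msupp u) _) (leqnn _)).
rewrite -big_split; apply: eq_bigr => n _; rewrite -big_split; apply: eq_bigr => i _.
by rewrite mcoeffD scalerDr monalgUD.
Qed.

Lemma lpolyZ0 p : lpolyZ p 0 = 0.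
Proof. by rewrite /lpolyZ msupp0 big_seq_fset0. Qed.

Lemma lpoly0Z v : lpolyZ 0 v = 0.
Proof. by rewrite /lpolyZ big1 // => n _; rewrite size_poly0 big_ord0. Qed.

Lemma lpolyZmon (c : A) i (v : V) n :
  lpolyZ (c *: 'X^i) << v *g n >> = << c *: v *g (i + n)%N >>.
Proof.
have szle : (size (c *: 'X^i) <= i.+1)%N by rewrite (leq_trans (size_scale_leq _ _)) ?size_polyXn.
rewrite (lpolyZw msuppU_le szle) big_seq_fset1 mcoeffUU big_ord_recr /= big1 ?add0r.
  by rewrite coefZ coefXn eqxx mulr1.
by move=> j _; rewrite coefZ coefXn (ltn_eqF (ltn_ord j)) mulr0 scale0r monalgU0.
Qed.

Lemma lpoly_sumZ (I : Type) (r : seq I) (F : I -> {poly A}) v :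
  lpolyZ (\sum_(i <- r) F i) v = \sum_(i <- r) lpolyZ (F i) v.
Proof. exact: (big_morph (lpolyZ^~ v) (@lpolyZDl v) (lpoly0Z v)). Qed.

Lemma lpolyZ_sum (I : Type) (r : seq I) (F : I -> lpoly V) p :
  lpolyZ p (\sum_(i <- r) F i) = \sum_(i <- r) lpolyZ p (F i).
Proof. exact: (big_morph (lpolyZ p) (@lpolyZDr p) (lpolyZ0 p)). Qed.

Lemma poly_monE (p : {poly A}) : p = \sum_(i < size p) p`_i *: 'X^i.
Proof. by rewrite -poly_def coefK. Qed.

Lemma lpoly_ind (P : lpoly V -> Prop) :
  P 0 -> (forall u v, P u -> P v -> P (u + v)) ->
  (forall (v : V) n, P << v *g n >>) -> forall v, P v.
Proof.
move=> P0 PD PU v; rewrite (monalgE (v : {malg V[nat]})).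
by elim/big_ind: _ => // n _; apply: PU.
Qed.

Lemma lpolyZA p q v : lpolyZ p (lpolyZ q v) = lpolyZ (p * q) v.
Proof.
elim/lpoly_ind: v => [|u v IHu IHv|v n].
- by rewrite !lpolyZ0.
- by rewrite !lpolyZDr IHu IHv.
rewrite (poly_monE p) (poly_monE q) mulr_suml !lpoly_sumZ; apply: eq_bigr => i _.
rewrite mulr_sumr !lpoly_sumZ lpolyZ_sum; apply: eq_bigr => j _.
rewrite !lpolyZmon scalerA addnA -lpolyZmon; congr lpolyZ.
by rewrite -[in RHS]scalerAl -(commr_polyXn (q`_j *: 'X^j) i) -[in RHS]scalerAl scalerA -exprD addnC.
Qed.

Lemma lpoly1Z v : lpolyZ 1 v = v.
Proof.
elim/lpoly_ind: v => [|u v IHu IHv|v n]; first by rewrite lpolyZ0.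
  by rewrite lpolyZDr IHu IHv.
have -> : 1 = 1 *: 'X^0 :> {poly A} by rewrite scale1r.
by rewrite lpolyZmon scale1r.
Qed.

HB.instance Definition _ := GRing.Zmodule_isLmodule.Build {poly A} (lpoly V)
  lpolyZA lpoly1Z lpolyZDr (fun v => @lpolyZDl v).

End Lpoly.

Definition lconst (A : nzRingType) (V : lmodType A) (v : V) : lpoly V := << v *g 0%N >>.
Arguments lconst {A V} v.

(* \sum_n t ^+ n *: f v_n, for p = \sum_n 'X^n v_n. *)
Definition lsubst (A B : nzRingType) (V : lmodType A) (W : lmodType B)
    (f : V -> W) (t : B) (p : lpoly V) : W :=
  \sum_(n <- msupp p) t ^+ n *: f p@_n.

(* The variables d, lambda of C[d][lambda], and lambda, mu of
   C[d][lambda][mu]. *)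
Declare Scope lambda_scope.
Notation "'\d'" := ('X%:P : {poly {poly _}}) (at level 0) : lambda_scope.
Notation "'\l'" := ('X : {poly {poly _}}) (at level 0) : lambda_scope.
Notation "'\l2'" := ('X%:P : {poly {poly {poly _}}}) (at level 0) : lambda_scope.
Notation "'\m2'" := ('X : {poly {poly {poly _}}}) (at level 0) : lambda_scope.
Local Open Scope lambda_scope.

Section LieConformal.
Context {C : comNzRingType} {R : lmodType {poly C}}.

Definition lsubst2 (t : {poly {poly {poly C}}}) : lpoly R -> lpoly (lpoly R) :=
  lsubst (fun v => lconst (lconst v)) t.

Record lie_conformal := LieConformal {
  lbr :> R -> R -> lpoly R;
  lbr_linearl : forall (c : C) x x' y,
    lbr (c%:P *: x + x') y = c%:P%:P *: lbr x y + lbr x' y;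
  lbr_linearr : forall (c : C) x y y',
    lbr x (c%:P *: y + y') = c%:P%:P *: lbr x y + lbr x y';
  lbr_dl : forall x y, lbr ('X *: x) y = - (\l *: lbr x y);
  lbr_dr : forall x y, lbr x ('X *: y) = (\d + \l) *: lbr x y;
  lbr_skew : forall x y, lbr x y = - lsubst lconst (- \l - \d) (lbr y x);
  lbr_jacobi : forall x y z,
    lsubst (fun v => lconst (lbr x v)) \m2 (lbr y z) =
    lsubst (fun u => lsubst2 (\l2 + \m2) (lbr u z)) \l2 (lbr x y)
    + lsubst (fun v => lsubst2 \m2 (lbr y v)) \l2 (lbr x z)
}.

Definition conformal_derivation (br : lie_conformal) (D : R -> lpoly R) : Prop :=
  [/\ forall (c : C) x y, D (c%:P *: x + y) = c%:P%:P *: D x + D y,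
      forall x, D ('X *: x) = (\d + \l) *: D x
    & forall x y,
        lsubst (fun v => lconst (D v)) \m2 (br x y) =
        lsubst (fun u => lsubst2 (\l2 + \m2) (br u y)) \l2 (D x)
        + lsubst (fun v => lsubst2 \m2 (br x v)) \l2 (D y)].

Local Open Scope classical_set_scope.

Definition CDer (br : lie_conformal) : set (R -> lpoly R) :=
  [set D | conformal_derivation br D].

Definition CInn (br : lie_conformal) : set (R -> lpoly R) :=
  [set (br x : R -> lpoly R) | x in [set: R]].

End LieConformal.
Arguments lie_conformal {C} R.

(* Internal direct sum, for linear subspaces F1 and F2. *)
Definition direct_sum (U : Type) (V : zmodType) (E F1 F2 : set (U -> V)) : Prop :=
  (E = [set f \+ g | f in F1 & g in F2] /\ F1 `&` F2 = [set \0])%classic.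

Section LsubstTheory.
Context {A : nzRingType} {V : lmodType A} {B : comNzRingType} {W : lmodType B}.
Implicit Types (f : V -> W) (t : B) (p q : lpoly V).

Lemma lsubstw f t p (d : {fset nat}) : f 0 = 0 -> (msupp p `<=` d)%fset ->
  lsubst f t p = \sum_(n <- d) t ^+ n *: f p@_n.
Proof.
move=> f0 le_d; rewrite /lsubst (big_fset_incl _ le_d) //= => n _.
by move/mcoeff_outdom => ->; rewrite f0 scaler0.
Qed.

Lemma lsubstD f t p q : {morph f : u v / u + v} -> f 0 = 0 ->
  lsubst f t (p + q) = lsubst f t p + lsubst f t q.
Proof.
move=> fD f0; rewrite (lsubstw _ f0 (msuppD_le p q)).
rewrite (lsubstw _ f0 (fsubsetUl _ (msupp q))) (lsubstw _ f0 (fsubsetUr (msupp p) _)).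
by rewrite -big_split; apply: eq_bigr => n _; rewrite mcoeffD fD scalerDr.
Qed.

Lemma lsubstU f t v n : f 0 = 0 -> lsubst f t << v *g n >> = t ^+ n *: f v.
Proof. by move=> f0; rewrite (lsubstw _ f0 msuppU_le) big_seq_fset1 mcoeffUU. Qed.

Lemma lsubst0 f t : lsubst f t 0 = 0.
Proof. by rewrite /lsubst msupp0 big_seq_fset0. Qed.

Lemma lsubst_const f t v : f 0 = 0 -> lsubst f t (lconst v) = f v.
Proof. by move=> f0; rewrite lsubstU // expr0 scale1r. Qed.

Lemma lsubstX f t p : {morph f : u v / u + v} -> f 0 = 0 ->
  lsubst f t ('X *: p) = t *: lsubst f t p.
Proof.
move=> fD f0; elim/(@lpoly_ind A V): p => [|u v IHu IHv|v n].
- by rewrite scaler0 lsubst0 scaler0.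
- by rewrite scalerDr !lsubstD // IHu IHv scalerDr.
have -> : 'X *: (<< v *g n >> : lpoly V) = << v *g n.+1 >>.
  by rewrite -['X]scale1r -(expr1 'X) [_ *: _]lpolyZmon scale1r add1n.
by rewrite !lsubstU // exprS scalerA.
Qed.

Lemma lsubstC f t p c d : {morph f : u v / u + v} -> f 0 = 0 ->
  (forall v, f (c *: v) = d *: f v) -> lsubst f t (c%:P *: p) = d *: lsubst f t p.
Proof.
move=> fD f0 fc; elim/(@lpoly_ind A V): p => [|u v IHu IHv|v n].
- by rewrite scaler0 lsubst0 scaler0.
- by rewrite scalerDr !lsubstD // IHu IHv scalerDr.
have -> : c%:P *: (<< v *g n >> : lpoly V) = << c *: v *g n >>.
  by rewrite -[c%:P]mulr1 mul_polyC -(expr0 'X) [_ *: _]lpolyZmon add0n.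
by rewrite !lsubstU // fc !scalerA mulrC.
Qed.

Lemma eq_lsubst f g t p : f =1 g -> lsubst f t p = lsubst g t p.
Proof. by move=> fg; apply: eq_bigr => n _; rewrite fg. Qed.

Lemma lsubst_funD f g t p : lsubst (fun v => f v + g v) t p = lsubst f t p + lsubst g t p.
Proof. by rewrite -big_split; apply: eq_bigr => n _; rewrite scalerDr. Qed.

Lemma lsubst_funZ d f t p : lsubst (fun v => d *: f v) t p = d *: lsubst f t p.
Proof. by rewrite scaler_sumr; apply: eq_bigr => n _; rewrite !scalerA mulrC. Qed.

End LsubstTheory.

Lemma lconstD (A : nzRingType) (V : lmodType A) : {morph @lconst A V : u v / u + v}.
Proof. exact: monalgUD. Qed.

Lemma lconst0 (A : nzRingType) (V : lmodType A) : @lconst A V 0 = 0.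
Proof. exact: monalgU0. Qed.

Lemma lconstZ (A : nzRingType) (V : lmodType A) c (v : V) :
  lconst (c *: v) = c%:P *: lconst v.
Proof. by rewrite -[c%:P]mulr1 mul_polyC -(expr0 'X) [RHS]lpolyZmon. Qed.

(* C-linear maps T with T (d x) = t (T x), where C acts on W through i. *)
Section Semilin.
Context {C B : comNzRingType} {R : lmodType {poly C}} {W : lmodType B} (i : C -> B).

Definition semilin (t : B) (T : R -> W) : Prop :=
  [/\ {morph T : x y / x + y}, T 0 = 0, forall c x, T (c%:P *: x) = i c *: T x
    & forall x, T ('X *: x) = t *: T x].

Lemma semilinD t T T' : semilin t T -> semilin t T' -> semilin t (fun x => T x + T' x).
Proof.
case=> [TD T0 TC TX] [TD' T0' TC' TX']; split=> [x y||c x|x] /=.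
- by rewrite TD TD' addrACA.
- by rewrite T0 T0' addr0.
- by rewrite TC TC' scalerDr.
- by rewrite TX TX' scalerDr.
Qed.

Lemma semilinN t T : semilin t T -> semilin t (fun x => - T x).
Proof.
case=> [TD T0 TC TX]; split=> [x y||c x|x] /=.
- by rewrite TD opprD.
- by rewrite T0 oppr0.
- by rewrite TC scalerN.
- by rewrite TX scalerN.
Qed.

Lemma semilin_eqt t t' T : t = t' -> semilin t T -> semilin t' T.
Proof. by move->. Qed.

Lemma semilin_eqZ t T T' x (p : {poly C}) : semilin t T -> semilin t T' ->
  T x = T' x -> T (p *: x) = T' (p *: x).
Proof.
case=> [TD T0 TC TX] [TD' T0' TC' TX'] E; elim/poly_ind: p => [|p c IH].
  by rewrite scale0r T0 T0'.
by rewrite scalerDl TD TD' TC TC' E mulrC -scalerA TX TX' IH.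
Qed.
End Semilin.

Section SemilinLsubst.
Context {C B : comNzRingType} {R R' : lmodType {poly C}} {W : lmodType B} (i : C -> B).
Implicit Types (T : R -> lpoly R') (f : R' -> W).

Let i2 (c : C) : {poly {poly C}} := c%:P%:P.

Lemma lsubstd f r t p : semilin i r f -> lsubst f t (\d *: p) = r *: lsubst f t p.
Proof. by case=> fD f0 _ fX; apply: lsubstC. Qed.

Lemma lsubstc f r t p c : semilin i r f -> lsubst f t (c%:P%:P *: p) = i c *: lsubst f t p.
Proof. by case=> fD f0 fc _; apply: lsubstC. Qed.

Lemma semilin_lsubst f r t T s s' : semilin i r f -> semilin i2 s T ->
  (forall p, lsubst f t (s *: p) = s' *: lsubst f t p) ->
  semilin i s' (fun x => lsubst f t (T x)).
Proof.
move=> sf [TD T0 Tc TX] E; have [fD f0 fc fX] := sf; split=> [x y||c x|x] /=.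
- by rewrite TD lsubstD.
- by rewrite T0 lsubst0.
- by rewrite Tc (lsubstc _ _ _ sf).
- by rewrite TX E.
Qed.

Lemma lsubstN f t p : {morph f : u v / u + v} -> f 0 = 0 ->
  lsubst f t (- p) = - lsubst f t p.
Proof.
by move=> fD f0; apply/eqP; rewrite -subr_eq0 opprK -lsubstD // addNr lsubst0.
Qed.

Lemma semilin_lsubst_Nl f r t T : semilin i r f -> semilin i2 (- \l) T ->
  semilin i (- t) (fun x => lsubst f t (T x)).
Proof.
move=> sf sT; apply: (semilin_lsubst sf sT) => p; have [fD f0 fc fX] := sf.
by rewrite !scaleNr lsubstN // lsubstX.
Qed.

Lemma semilin_lsubst_dl f r t T : semilin i r f -> semilin i2 (\d + \l) T ->
  semilin i (r + t) (fun x => lsubst f t (T x)).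
Proof.
move=> sf sT; apply: (semilin_lsubst sf sT) => p; have [fD f0 fc fX] := sf.
by rewrite !scalerDl lsubstD // lsubstX // (lsubstd _ _ sf).
Qed.

Lemma semilin_lsubst_fun (f : R -> R' -> W) r t p :
  (forall v, semilin i r (f^~ v)) -> semilin i r (fun x => lsubst (f x) t p).
Proof.
move=> sf; split=> [x y||c x|x] /=.
- by rewrite -lsubst_funD; apply: eq_lsubst => v; case: (sf v).
- by apply: big1 => n _; case: (sf p@_n) => _ -> _ _; rewrite scaler0.
- by rewrite -lsubst_funZ; apply: eq_lsubst => v; case: (sf v).
- by rewrite -lsubst_funZ; apply: eq_lsubst => v; case: (sf v).
Qed.
End SemilinLsubst.

Section SemilinConst.
Context {C B : comNzRingType} {R : lmodType {poly C}} {W : lmodType B} (i : C -> B).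
Lemma semilin_lconst t (T : R -> W) : semilin i t T ->
  semilin (fun c => (i c)%:P) t%:P (fun x => lconst (T x)).
Proof.
case=> TD T0 Tc TX; split=> [x y||c x|x] /=.
- by rewrite TD lconstD.
- by rewrite T0 lconst0.
- by rewrite Tc lconstZ.
- by rewrite TX lconstZ.
Qed.
End SemilinConst.

Lemma semilin_id (C : comNzRingType) (R : lmodType {poly C}) :
  semilin (@polyC C) 'X (fun x : R => x).
Proof. by split. Qed.

Variant csv_gen := GL | GM | GY.

Definition csv_gen_ord (g : csv_gen) : 'I_3 :=
  match g with GL => inord 0 | GM => inord 1 | GY => inord 2 end.
Definition csv_ord_gen (i : 'I_3) : csv_gen :=
  match val i with 0%N => GL | 1%N => GM | _ => GY end.
Lemma csv_gen_ordK : cancel csv_gen_ord csv_ord_gen.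
Proof. by case; rewrite /csv_ord_gen /= inordK. Qed.
HB.instance Definition _ := Choice.copy csv_gen (can_type csv_gen_ordK).

Definition csv (C : comNzRingType) : Type := {malg {poly C}[(int * csv_gen)%type]}.
HB.instance Definition _ (C : comNzRingType) := GRing.Lmodule.on (csv C).

Section CSV.
Context {C : numFieldType}.
Implicit Types (a b : C) (x y : csv C).

Definition csvL (i : int) : csv C := << (i, GL) >>.
Definition csvM (i : int) : csv C := << (i, GM) >>.
Definition csvY (i : int) : csv C := << (i, GY) >>.

Definition LM_coef a b (t : {poly {poly C}}) : {poly {poly C}} :=
  \d + a%:P%:P * t + b%:P%:P.
Definition LY_coef a b (t : {poly {poly C}}) : {poly {poly C}} :=
  \d + (a / 2 + 1)%:P%:P * t + (b / 2)%:P%:P.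

(* [M_i lambda L_j] and [Y_i lambda L_j] are given by skew-symmetry. *)
Definition csv_gen_br a b (k l : int * csv_gen) : lpoly (csv C) :=
  match k, l with
  | (i, GL), (j, GL) => (\d + 2 * \l) *: lconst (csvL (i + j))
  | (i, GL), (j, GM) => LM_coef a b \l *: lconst (csvM (i + j))
  | (i, GM), (j, GL) => - (LM_coef a b (- \l - \d) *: lconst (csvM (i + j)))
  | (i, GL), (j, GY) => LY_coef a b \l *: lconst (csvY (i + j))
  | (i, GY), (j, GL) => - (LY_coef a b (- \l - \d) *: lconst (csvY (i + j)))
  | (i, GY), (j, GY) => (\d + 2 * \l) *: lconst (csvM (i + j))
  | _, _ => 0
  end.

(* For p : C[d], the polynomials p(- lambda) and p(d + lambda). *)
Definition at_Nl (p : {poly C}) : {poly {poly C}} := map_poly polyC p \Po (- \l).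
Definition at_dl (p : {poly C}) : {poly {poly C}} := map_poly polyC p \Po (\d + \l).

Definition csv_br a b x y : lpoly (csv C) :=
  \sum_(k <- msupp x) \sum_(l <- msupp y)
    (at_Nl x@_k * at_dl y@_l) *: csv_gen_br a b k l.

End CSV.

Lemma malgUZ (A : nzRingType) (K : choiceType) (c : A) (k : K) :
  << c *g k >> = c *: << k >> :> {malg A[K]}.
Proof. by apply/malgP => l; rewrite mcoeffZ !mcoeffU mulrnAr mulr1. Qed.

Lemma semilin_ext (C B : comNzRingType) (W : lmodType B) (i : C -> B) t (T T' : csv C -> W) :
  semilin i t T -> semilin i t T' -> (forall k, T << k >> = T' << k >>) -> T =1 T'.
Proof.
move=> sT sT' E x; rewrite (monalgE x).
have [TD T0 _ _] := sT; have [TD' T0' _ _] := sT'.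
rewrite !(big_morph T TD T0) !(big_morph T' TD' T0'); apply: eq_bigr => k _.
rewrite malgUZ; exact: (semilin_eqZ _ sT sT' (E k)).
Qed.

Section SemilinExtend.
Context {C B : comNzRingType} {W : lmodType B}.
Variable e : {rmorphism {poly C} -> B}.
Variable F : int * csv_gen -> W.

Definition csv_extend (x : csv C) : W := \sum_(k <- msupp x) e x@_k *: F k.

Lemma csv_extendw x (d : {fset (int * csv_gen)}) : (msupp x `<=` d)%fset ->
  csv_extend x = \sum_(k <- d) e x@_k *: F k.
Proof.
move=> le_d; rewrite /csv_extend (big_fset_incl _ le_d) //= => k _.
by move/mcoeff_outdom => ->; rewrite rmorph0 scale0r.
Qed.

Lemma csv_extend_semilin : semilin (fun c => e c%:P) (e 'X) csv_extend.
Proof.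
split=> [x y||c x|x].
- rewrite (csv_extendw (msuppD_le x y)).
  rewrite (csv_extendw (fsubsetUl _ (msupp y))) (csv_extendw (fsubsetUr (msupp x) _)).
  by rewrite -big_split; apply: eq_bigr => k _; rewrite mcoeffD rmorphD scalerDl.
- by rewrite /csv_extend msupp0 big_seq_fset0.
- rewrite (csv_extendw (msuppZ_le _ _)) scaler_sumr; apply: eq_bigr => k _.
  by rewrite mcoeffZ rmorphM scalerA.
- rewrite (csv_extendw (msuppZ_le _ _)) scaler_sumr; apply: eq_bigr => k _.
  by rewrite mcoeffZ rmorphM scalerA.
Qed.

Lemma csv_extendX x : csv_extend ('X *: x) = e 'X *: csv_extend x.
Proof. by case: csv_extend_semilin. Qed.

Lemma csv_extend_gen k : csv_extend << k >> = F k.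
Proof. by rewrite (csv_extendw msuppU_le) big_seq_fset1 mcoeffUU rmorph1 scale1r. Qed.
End SemilinExtend.

Section CSVLie.
Context {C : numFieldType}.
Variables a b : C.
Notation br := (csv_br a b).
Notation i2 := (fun c : C => c%:P%:P : {poly {poly C}}).
Notation i3 := (fun c : C => c%:P%:P%:P : {poly {poly {poly C}}}).

HB.instance Definition _ := GRing.RMorphism.copy (@at_Nl C)
  (comp_poly (- \l) \o map_poly polyC).
HB.instance Definition _ := GRing.RMorphism.copy (@at_dl C)
  (comp_poly (\d + \l) \o map_poly polyC).

Lemma at_NlC (c : C) : at_Nl c%:P = c%:P%:P.
Proof. by rewrite /at_Nl map_polyC comp_polyC. Qed.
Lemma at_dlC (c : C) : at_dl c%:P = c%:P%:P.
Proof. by rewrite /at_dl map_polyC comp_polyC. Qed.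
Lemma at_NlX : at_Nl 'X = - \l :> {poly {poly C}}.
Proof. by rewrite /at_Nl map_polyX comp_polyX. Qed.
Lemma at_dlX : at_dl 'X = \d + \l :> {poly {poly C}}.
Proof. by rewrite /at_dl map_polyX comp_polyX. Qed.

Lemma semilin_eqi (B : comNzRingType) (R : lmodType {poly C}) (W : lmodType B)
    (i j : C -> B) t u (T : R -> W) :
  i =1 j -> t = u -> semilin i t T -> semilin j u T.
Proof. by move=> ij -> [TD T0 Tc TX]; split=> // c x; rewrite Tc ij. Qed.

Lemma semilin_eqT (B : comNzRingType) (R : lmodType {poly C}) (W : lmodType B)
    (i : C -> B) t (T T' : R -> W) :
  T =1 T' -> semilin i t T' -> semilin i t T.
Proof. by move=> E [TD T0 Tc TX]; split=> [x y||c x|x]; rewrite !E. Qed.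

Lemma csv_br_l y : semilin i2 (- \l) (br^~ y).
Proof.
apply: (semilin_eqT (T' := csv_extend (@at_Nl C)
   (fun k => \sum_(l <- msupp y) at_dl y@_l *: csv_gen_br a b k l))).
  move=> x; apply: eq_bigr => k _; rewrite scaler_sumr.
  by apply: eq_bigr => l _; rewrite scalerA.
exact: (semilin_eqi at_NlC at_NlX (csv_extend_semilin _ _)).
Qed.

Lemma csv_br_r x : semilin i2 (\d + \l) (br x).
Proof.
apply: (semilin_eqT (T' := csv_extend (@at_dl C)
   (fun l => \sum_(k <- msupp x) at_Nl x@_k *: csv_gen_br a b k l))).
  move=> y; rewrite /csv_br exchange_big; apply: eq_bigr => l _; rewrite scaler_sumr.
  by apply: eq_bigr => k _; rewrite scalerA mulrC.
exact: (semilin_eqi at_dlC at_dlX (csv_extend_semilin _ _)).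
Qed.

Lemma csv_brE x y : br x y =
  csv_extend (@at_Nl C) (fun k => csv_extend (@at_dl C) (csv_gen_br a b k) y) x.
Proof.
apply: eq_bigr => k _; rewrite /csv_extend scaler_sumr.
by apply: eq_bigr => l _; rewrite scalerA.
Qed.

Lemma csv_br_gen k l : br << k >> << l >> = csv_gen_br a b k l.
Proof. by rewrite csv_brE !csv_extend_gen. Qed.

(* [e_k lambda e_l] = (A d + B lambda + G) e_(k.1 + l.1, csv_tgt k.2 l.2), where
   csv_cf k.2 l.2 = (A, B, G). *)
Definition csv_tgt (g h : csv_gen) : csv_gen :=
  match g, h with
  | GL, GL => GL | GL, GY | GY, GL => GY | _, _ => GM end.

Definition csv_cf (g h : csv_gen) : C * C * C :=
  match g, h with
  | GL, GL | GY, GY => (1, 2, 0)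
  | GL, GM => (1, a, b)
  | GM, GL => (a - 1, a, - b)
  | GL, GY => (1, a / 2 + 1, b / 2)
  | GY, GL => (a / 2, a / 2 + 1, - (b / 2))
  | _, _ => 0
  end.

Definition csv_lin (B : comNzRingType) (i : C -> B) (c : C * C * C) (d t : B) : B :=
  i c.1.1 * d + i c.1.2 * t + i c.2.

Lemma csv_gen_brE k l : csv_gen_br a b k l =
  csv_lin i2 (csv_cf k.2 l.2) \d \l *: lconst << (k.1 + l.1, csv_tgt k.2 l.2) >>.
Proof.
case: k l => i [] [j []]; rewrite /csv_lin /= ?[lconst _]/(lconst _); 
  rewrite ?(scale0r, mul0r, add0r) // -?scaleNr; congr (_ *: _);
  rewrite /LM_coef /LY_coef; ring.
Qed.

Lemma lsubst_lin (B : comNzRingType) (R' : lmodType {poly C}) (W : lmodType B)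
    (i : C -> B) r t (f : R' -> W) c p : semilin i r f ->
  lsubst f t (csv_lin i2 c \d \l *: p) = csv_lin i c r t *: lsubst f t p.
Proof.
move=> sf; have [fD f0 _ _] := sf.
rewrite /csv_lin !scalerDl !lsubstD // -!scalerA.
by rewrite !(lsubstc _ _ _ sf) (lsubstd _ _ sf) (lsubstX _ _ fD f0).
Qed.

Lemma jac_poly g1 g2 g3 (B : comNzRingType) (i : {rmorphism C -> B}) (D L M : B) :
  csv_lin i (csv_cf g2 g3) (D + L) M * csv_lin i (csv_cf g1 (csv_tgt g2 g3)) D L =
  csv_lin i (csv_cf g1 g2) (- (L + M)) L * csv_lin i (csv_cf (csv_tgt g1 g2) g3) D (L + M)
  + csv_lin i (csv_cf g1 g3) (D + M) L * csv_lin i (csv_cf g2 (csv_tgt g1 g3)) D M.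
Proof.
have Ea : a = 2 * (a / 2) by field.
have Eb : b = 2 * (b / 2) by field.
rewrite /csv_cf /csv_lin; move: Ea Eb; move: (a / 2) (b / 2) => h h' -> ->.
case: g1 g2 g3 => [] [] [] /=; rewrite ?(rmorph0, mul0r, mulr0, addr0, add0r) //; ring.
Qed.

Section Generators.
Context {R : lmodType {poly C}}.
Variables (B : R -> R -> lpoly R) (e : int * csv_gen -> R).
Hypothesis Bl : forall y, semilin i2 (- \l) (B^~ y).
Hypothesis Br : forall x, semilin i2 (\d + \l) (B x).
Hypothesis BE : forall k l,
  B (e k) (e l) = csv_lin i2 (csv_cf k.2 l.2) \d \l *: lconst (e (k.1 + l.1, csv_tgt k.2 l.2)).

Let c1 : semilin i2 \d (fun v : R => lconst v).
Proof. exact: (semilin_lconst (semilin_id _)). Qed.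

Lemma skew_lin :
  (forall z, semilin i2 (- \l) (fun x => - lsubst lconst (- \l - \d) (B z x))) /\
  (forall z, semilin i2 (\d + \l) (fun y => - lsubst lconst (- \l - \d) (B y z))).
Proof.
split=> z.
- apply: semilin_eqt (semilinN (semilin_lsubst_dl _ c1 (Br z))); ring.
- apply: semilin_eqt (semilinN (semilin_lsubst_Nl _ c1 (Bl z))); ring.
Qed.

Lemma skew_gen k l : B (e k) (e l) = - lsubst lconst (- \l - \d) (B (e l) (e k)).
Proof.
rewrite (BE k l) (BE l k) (lsubst_lin _ _ _ c1) (lsubst_const _ _ (lconst0 R)).
rewrite -scaleNr [l.1 + _]addrC.
have -> : csv_tgt l.2 k.2 = csv_tgt k.2 l.2 by case: k l => [? []] [? []].
congr (_ *: _); case: k l => [i []] [j []] /=; rewrite /csv_lin /=; ring.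
Qed.

Let jac1 x y z := lsubst (fun v => lconst (B x v)) \m2 (B y z).
Let jac2 x y z := lsubst (fun u => lsubst2 (\l2 + \m2) (B u z)) \l2 (B x y).
Let jac3 x y z := lsubst (fun v => lsubst2 \m2 (B y v)) \l2 (B x z).
Let cc : semilin i3 (\d)%:P (fun v : R => lconst (lconst v)).
Proof. exact: (semilin_lconst (semilin_lconst (semilin_id _))). Qed.

Let s1l v : semilin i3 (- \l2) (fun x => lconst (B x v)).
Proof. by apply: semilin_eqt (semilin_lconst (Bl v)); rewrite polyCN. Qed.
Let s1r u : semilin i3 (\d + \l)%:P (fun v => lconst (B u v)).
Proof. exact: (semilin_lconst (Br u)). Qed.
Let s2l t v : semilin i3 (- t) (fun u => lsubst2 t (B u v)).
Proof. exact: (semilin_lsubst_Nl _ cc (Bl v)). Qed.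
Let s2r t u : semilin i3 ((\d)%:P + t) (fun v => lsubst2 t (B u v)).
Proof. exact: (semilin_lsubst_dl _ cc (Br u)). Qed.

Lemma jac_lin1 y z : semilin i3 (- \l2) (fun x => jac1 x y z) /\
  semilin i3 (- \l2) (fun x => jac2 x y z + jac3 x y z).
Proof.
split; first by apply: semilin_lsubst_fun => v; apply: s1l.
apply: semilinD; last exact: (semilin_lsubst_Nl _ (s2r _ _) (Bl _)).
exact: (semilin_lsubst_Nl _ (s2l _ _) (Bl _)).
Qed.

Lemma jac_lin2 x z : semilin i3 (- \m2) (fun y => jac1 x y z) /\
  semilin i3 (- \m2) (fun y => jac2 x y z + jac3 x y z).
Proof.
split; first exact: (semilin_lsubst_Nl _ (s1r _) (Bl _)).
apply: semilinD; last by apply: semilin_lsubst_fun => v; apply: s2l.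
apply: semilin_eqt (semilin_lsubst_dl _ (s2l _ _) (Br _)); ring.
Qed.

Lemma jac_lin3 x y : semilin i3 ((\d)%:P + \l2 + \m2) (jac1 x y) /\
  semilin i3 ((\d)%:P + \l2 + \m2) (fun z => jac2 x y z + jac3 x y z).
Proof.
split; first by apply: semilin_eqt (semilin_lsubst_dl _ (s1r _) (Br _)); ring.
apply: semilinD.
  by apply: semilin_lsubst_fun => v; apply: semilin_eqt (s2r _ _); rewrite addrA.
apply: semilin_eqt (semilin_lsubst_dl _ (s2r _ _) (Br _)); ring.
Qed.

Lemma jac_gen k l m :
  jac1 (e k) (e l) (e m) = jac2 (e k) (e l) (e m) + jac3 (e k) (e l) (e m).
Proof.
have E t p q : lsubst2 t (B (e p) (e q)) =
    csv_lin i3 (csv_cf p.2 q.2) (\d)%:P t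
      *: lconst (lconst (e (p.1 + q.1, csv_tgt p.2 q.2))).
  by rewrite BE /lsubst2 (lsubst_lin _ _ _ cc) lsubst_const ?lconst0.
rewrite /jac1 /jac2 /jac3 (BE l m) (BE k l) (BE k m).
rewrite (lsubst_lin _ _ _ (s1r _)) (lsubst_lin _ _ _ (s2l _ _)) (lsubst_lin _ _ _ (s2r _ _)).
have [_ z1 _ _] := s1r (e k); have [_ z2 _ _] := s2l (\l2 + \m2) (e m).
have [_ z3 _ _] := s2r \m2 (e l).
rewrite !lsubst_const // !E BE lconstZ !scalerA.
move: cc => _; rewrite /= !addrA [l.1 + k.1]addrC.
move: (k.1 + l.1 + m.1) (k.2) (l.2) (m.2) => n g1 g2 g3.
have -> : csv_tgt (csv_tgt g1 g2) g3 = csv_tgt g1 (csv_tgt g2 g3) by case: g1 g2 g3 => [] [] [].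
have -> : csv_tgt g2 (csv_tgt g1 g3) = csv_tgt g1 (csv_tgt g2 g3) by case: g1 g2 g3 => [] [] [].
rewrite -scalerDl; congr (_ *: _).
have -> c : (csv_lin i2 c \d \l)%:P = csv_lin i3 c (\d)%:P \l2.
  by rewrite /csv_lin !polyCD !polyCM.
rewrite polyCD.
exact: (jac_poly g1 g2 g3 (polyC \o (polyC \o polyC)) (\d)%:P \l2 \m2).
Qed.
End Generators.

Lemma csv_skew x y : br x y = - lsubst lconst (- \l - \d) (br y x).
Proof.
have [Sl Sr] := skew_lin csv_br_l csv_br_r.
apply: (semilin_ext (csv_br_l y) (Sl y)) => {x} k.
apply: (semilin_ext (csv_br_r << k >>) (Sr << k >>)) => {y} l.
apply: (skew_gen (e := fun k => << k >>)) => p q.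
by rewrite csv_br_gen csv_gen_brE.
Qed.

Lemma csv_jacobi x y z :
  lsubst (fun v => lconst (br x v)) \m2 (br y z) =
  lsubst (fun u => lsubst2 (\l2 + \m2) (br u z)) \l2 (br x y)
  + lsubst (fun v => lsubst2 \m2 (br y v)) \l2 (br x z).
Proof.
have [J1 J1'] := jac_lin1 csv_br_l csv_br_r y z.
apply: (semilin_ext J1 J1') => {x J1 J1'} k.
have [J2 J2'] := jac_lin2 csv_br_l csv_br_r << k >> z.
apply: (semilin_ext J2 J2') => {y J2 J2'} l.
have [J3 J3'] := jac_lin3 csv_br_r << k >> << l >>.
apply: (semilin_ext J3 J3') => {z J3 J3'} m.
apply: (jac_gen csv_br_l csv_br_r (e := fun k => << k >>)) => p q.
by rewrite csv_br_gen csv_gen_brE.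
Qed.

End CSVLie.

Section CSVAxioms.
Context {C : numFieldType}.
Variables a b : C.

Lemma csv_br_linearl (c : C) (x x' y : csv C) :
  csv_br a b (c%:P *: x + x') y = c%:P%:P *: csv_br a b x y + csv_br a b x' y.
Proof. by case: (csv_br_l a b y) => D _ Z _; rewrite D Z. Qed.

Lemma csv_br_linearr (c : C) (x y y' : csv C) :
  csv_br a b x (c%:P *: y + y') = c%:P%:P *: csv_br a b x y + csv_br a b x y'.
Proof. by case: (csv_br_r a b x) => D _ Z _; rewrite D Z. Qed.

Lemma csv_br_dl (x y : csv C) : csv_br a b ('X *: x) y = - (\l *: csv_br a b x y).
Proof. by case: (csv_br_l a b y) => _ _ _ X; rewrite X scaleNr. Qed.

Lemma csv_br_dr (x y : csv C) : csv_br a b x ('X *: y) = (\d + \l) *: csv_br a b x y.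
Proof. by case: (csv_br_r a b x) => _ _ _ X; rewrite X. Qed.

Definition CSV : lie_conformal (csv C) :=
  LieConformal csv_br_linearl csv_br_linearr csv_br_dl csv_br_dr
    (csv_skew a b) (csv_jacobi a b).

End CSVAxioms.

Section Dvec.
Context {C : numFieldType}.

Definition Dvec_gen (v : {malg C[int]}) (k : int * csv_gen) : lpoly (csv C) :=
  match k with
  | (i, GL) => \sum_(c <- msupp v) (v@_c)%:P%:P *: lconst (csvM (i + c))
  | _ => 0
  end.

(* The extension of the values on generators by D_lambda (d x) = (d + lambda) D_lambda x. *)
Definition Dvec (v : {malg C[int]}) : csv C -> lpoly (csv C) :=
  @csv_extend C _ (lpoly (csv C)) (@at_dl C) (Dvec_gen v).

Lemma DvecL v i :
  Dvec v (csvL i) = \sum_(c <- msupp v) (v@_c)%:P%:P *: lconst (csvM (i + c)).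
Proof. exact: csv_extend_gen. Qed.

Lemma DvecM v i : Dvec v (csvM i) = 0.
Proof. exact: csv_extend_gen. Qed.

Lemma DvecY v i : Dvec v (csvY i) = 0.
Proof. exact: csv_extend_gen. Qed.

Lemma Dvec_dl v x : Dvec v ('X *: x) = (\d + \l) *: Dvec v x.
Proof. by rewrite /Dvec csv_extendX; congr (_ *: _); exact: at_dlX. Qed.

Definition Cinfty : set (csv C -> lpoly (csv C)) :=
  [set Dvec v | v in [set: {malg C[int]}]]%classic.

End Dvec.
Arguments Cinfty C : clear implicits.

(* Main.v *)
Require Import Defs.
From mathcomp Require Import all_boot all_order all_algebra.
From mathcomp Require Import finmap monalg complex classical_sets reals.
From mathcomp Require Import boolp ring.

Import GRing.Theory.

(** Why the theorem holds.  Let the zero mode of [L_0 mu -] be its value at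
    mu = 0.  It acts on every generator e_k by d + beta_k, where the weight beta_k is
    0, b or b/2 according as e_k is some L_i, M_i or Y_i.  Compare the
    coefficients of mu^0 in the derivation rule for [L_0 mu e_k]: the term
    [(D_lambda L_0)_lambda e_k] is [w_lambda e_k] for the element w of the
    algebra obtained from D_lambda L_0 by the substitution lambda := -d, and
    on the coordinate along e_m the rule becomes

      (lambda + beta_k - beta_m) (D_lambda e_k)_m = [w_lambda e_k]_m.

    As lambda + beta_k - beta_m is a nonzero polynomial, D is determined by w
    ([derivation_weight]).

    The weights are additive along the brackets, so for every x the inner
    derivation ad x satisfies the same equation with w := -(d + beta) x
    ([br_weight]).  Dividing each coordinate of w by d + beta_k thus accounts for
    all of w by an inner derivation, except for the remainders, which are
    constants.  The equation at the value of lambda that kills its left hand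
    side shows that these remainders vanish along L (evaluate on L_0) and along
    Y (evaluate on Y_0), and that a - 1 times the remainder along M vanishes
    (evaluate on L_0 again): [residue_L], [residue_Y], [residue_M].  For a = 1
    the remaining constants along M are the coefficients of an outer derivation
    of the family C^infty, which satisfies the equation too ([Dvec_weight]).
    Hence CDer is contained in the sum ([CDer_decomposition]).

    Conversely the outer maps are derivations ([Dvec_conformal_derivation]), and
    the sum is direct because the coordinates along the M_c of [x_lambda L_0]
    are multiples of lambda - b when a = 1, whereas those of an outer
    derivation are constants ([inner_outer_disjoint]). *)

(** * Constant terms and substitution *)

Section ConstantTerm.
Set Implicit Arguments.
Unset Strict Implicit.
Local Open Scope ring_scope.
Local Open Scope lambda_scope.

Section Module.
Context {A : nzRingType} {V : lmodType A}.

Lemma mcoeff_scaleX_lpoly (v : lpoly V) : ('X *: v)@_0%N = 0.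
Proof.
elim/(@lpoly_ind A V): v => [|u v IHu IHv|v n].
- by rewrite scaler0 mcoeff0.
- by rewrite scalerDr mcoeffD IHu IHv addr0.
have -> : 'X *: (<< v *g n >> : lpoly V) = << v *g n.+1 >>.
  by rewrite -['X]scale1r -(expr1 'X) [_ *: _]lpolyZmon scale1r add1n.
by rewrite mcoeffU.
Qed.

Lemma mcoeff_scaleC_lpoly (c : A) (v : lpoly V) n : (c%:P *: v)@_n = c *: v@_n.
Proof.
elim/(@lpoly_ind A V): v => [|u v IHu IHv|v m].
- by rewrite scaler0 mcoeff0 scaler0.
- by rewrite scalerDr !mcoeffD IHu IHv scalerDr.
have -> : c%:P *: (<< v *g m >> : lpoly V) = << c *: v *g m >>.
  by rewrite -[c%:P]mulr1 mul_polyC -(expr0 'X) [_ *: _]lpolyZmon add0n.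
by rewrite !mcoeffU scalerMnr.
Qed.

Lemma mcoeff0_scale_lpoly (r : {poly A}) (v : lpoly V) : (r *: v)@_0%N = r`_0 *: v@_0%N.
Proof.
elim/poly_ind: r v => [|r c IH] v; first by rewrite coef0 !scale0r mcoeff0.
rewrite scalerDl mcoeffD -scalerA IH mcoeff_scaleX_lpoly mcoeff_scaleC_lpoly scaler0.
by rewrite coefD coefMX coefC !add0r.
Qed.

End Module.

Context {A B : comNzRingType} {V : lmodType A}.

(** Taking the constant term in the variable of [t] is compatible with the
    module structures, hence with substitution. *)
Lemma mcoeff0_lsubst {W : lmodType B} (f : V -> lpoly W) (t : {poly B}) p :
  (lsubst f t p)@_0%N = lsubst (fun v => (f v)@_0%N) t`_0 p.
Proof.
rewrite /lsubst raddf_sum; apply: eq_bigr => n _ /=.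
by rewrite [LHS]mcoeff0_scale_lpoly -!horner_coef0 horner_exp.
Qed.

Lemma lsubst_at0 {W : lmodType B} (f : V -> W) p : f 0 = 0 -> lsubst f 0 p = f p@_0%N.
Proof.
move=> f0; rewrite (lsubstw _ f0 (fsubsetUr [fset 0%N]%fset _)) (big_fsetD1 0%N) /=; last first.
  by rewrite !inE.
rewrite expr0 scale1r big1_fset ?addr0 // => n; rewrite !inE => /andP[n0 _] _.
by rewrite expr0n (negbTE n0) scale0r.
Qed.

Lemma lsubst_lconst (p : lpoly V) : lsubst lconst 'X p = p.
Proof.
have [D0 Z0] := (@lconstD A V, @lconst0 A V).
elim/(@lpoly_ind A V): p => [|u v IHu IHv|v n]; first by rewrite lsubst0.
  by rewrite lsubstD // IHu IHv.
rewrite lsubstU // /lconst -['X^n]scale1r -[LHS]/(lpolyZ _ _).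
by rewrite (lpolyZmon (A:=A)) addn0 scale1r.
Qed.

End ConstantTerm.

(** * Conformal derivations and the zero mode *)

Section Derivations.
Set Implicit Arguments.
Unset Strict Implicit.
Local Open Scope ring_scope.
Local Open Scope lambda_scope.

Context {C : comNzRingType} {R : lmodType {poly C}}.
Implicit Types (br : lie_conformal R) (D : R -> lpoly R).
Notation i2 := (fun c : C => c%:P%:P : {poly {poly C}}).
Notation i3 := (fun c : C => c%:P%:P%:P : {poly {poly {poly C}}}).

Lemma linear_semilin {W : lmodType {poly {poly C}}} (t : {poly {poly C}}) (T : R -> W) :
  (forall (c : C) x y, T (c%:P *: x + y) = c%:P%:P *: T x + T y) ->
  (forall x, T ('X *: x) = t *: T x) -> semilin i2 t T.
Proof.
move=> TZD TX.
have TD : {morph T : x y / x + y} by move=> x y; move: (TZD 1 x y); rewrite !scale1r.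
have T0 : T 0 = 0 by apply: (addrI (T 0)); rewrite -TD !addr0.
by split=> // c x; move: (TZD c x 0); rewrite T0 !addr0.
Qed.

Lemma semilin_linear (t : {poly {poly C}}) (T : R -> lpoly R) : semilin i2 t T ->
  forall (c : C) x y, T (c%:P *: x + y) = c%:P%:P *: T x + T y.
Proof. by case=> TD _ TZ _ c x y; rewrite TD TZ. Qed.

Lemma lbr_semilinl br y : semilin i2 (- \l) (br^~ y).
Proof.
apply: linear_semilin => [c x x'|x]; first exact: lbr_linearl.
by rewrite lbr_dl scaleNr.
Qed.

Lemma lbr_semilinr br x : semilin i2 (\d + \l) (br x).
Proof. by apply: linear_semilin => [c y y'|y]; [exact: lbr_linearr|exact: lbr_dr]. Qed.

Lemma conformal_derivation_semilin br D :
  conformal_derivation br D -> semilin i2 (\d + \l) D.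
Proof. by case=> DZ DX _; apply: linear_semilin. Qed.

Lemma lsubst2_semilinl br t y : semilin i3 (- t) (fun u => lsubst2 t (br u y)).
Proof.
apply: semilin_lsubst_Nl (lbr_semilinl br y).
exact: (semilin_lconst (semilin_lconst (semilin_id _))).
Qed.

Lemma lsubst2_semilinr br t x : semilin i3 ((\d)%:P + t) (fun u => lsubst2 t (br x u)).
Proof.
apply: semilin_lsubst_dl (lbr_semilinr br x).
exact: (semilin_lconst (semilin_lconst (semilin_id _))).
Qed.

Lemma conformal_derivationD br D D' : conformal_derivation br D ->
  conformal_derivation br D' -> conformal_derivation br (D \+ D').
Proof.
move=> dD dD'; have sD := conformal_derivation_semilin dD.
have sD' := conformal_derivation_semilin dD'; have sDD' := semilinD sD sD'.
have [_ _ ED] := dD; have [_ _ ED'] := dD'.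
split; [exact: semilin_linear sDD'|by case: sDD'|move=> x y].
have -> : (fun v => lconst ((D \+ D') v)) = (fun v => lconst (D v) + lconst (D' v)).
  by apply/funext => v; rewrite /= lconstD.
rewrite lsubst_funD ED ED' /=.
have [lD l0 _ _] := lsubst2_semilinl br (\l2 + \m2) y.
have [rD r0 _ _] := lsubst2_semilinr br \m2 x.
rewrite (lsubstD _ _ _ lD l0) (lsubstD _ _ _ rD r0).
exact: addrACA.
Qed.

Lemma inner_conformal_derivation br x : conformal_derivation br (br x).
Proof. by split=> *; [exact: lbr_linearr|exact: lbr_dr|exact: lbr_jacobi]. Qed.

(** The coefficient of mu^0 in the derivation rule for [x mu y].  Setting mu = 0
    turns lambda + mu into lambda, so nothing but the zero mode of [x mu -]
    survives from the brackets with [x]. *)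
Lemma conformal_derivation_at0 br D x y : conformal_derivation br D ->
  D (br x y)@_0%N =
    lsubst (br^~ y) \l (D x) + lsubst (fun v => lconst (br x v)@_0%N) \l (D y).
Proof.
move=> dD; have [_ _ E] := dD.
have [DD D0 _ _] := conformal_derivation_semilin dD.
have E1 : (lsubst (fun v => lconst (D v)) \m2 (br x y))@_0%N = D (br x y)@_0%N.
  rewrite mcoeff0_lsubst coefX /= lsubst_at0; first exact: mcoeffUU.
  by rewrite D0 lconst0 mcoeff0.
have E2 : (lsubst (fun u => lsubst2 (\l2 + \m2) (br u y)) \l2 (D x))@_0%N =
    lsubst (br^~ y) \l (D x).
  rewrite mcoeff0_lsubst coefC /=; apply: eq_lsubst => u.
  rewrite mcoeff0_lsubst coefD coefC coefX /= addr0 -[RHS]lsubst_lconst.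
  by apply: eq_lsubst => v; exact: mcoeffUU.
have E3 : (lsubst (fun v => lsubst2 \m2 (br x v)) \l2 (D y))@_0%N =
    lsubst (fun v => lconst (br x v)@_0%N) \l (D y).
  rewrite mcoeff0_lsubst coefC /=; apply: eq_lsubst => u.
  rewrite mcoeff0_lsubst coefX /= lsubst_at0; first exact: mcoeffUU.
  by rewrite !lconst0 mcoeff0.
rewrite -E1 -E2 -E3 E; exact: mcoeffD.
Qed.

(** The value of [p] at lambda = -d. *)
Definition at_Nd (p : lpoly R) : R := lsubst (fun u : R => u) (- 'X) p.

(** Sesquilinearity, [(d u)_lambda y] = - lambda [u_lambda y], absorbs the powers
    of lambda in [p] into powers of -d. *)
Lemma lbr_at_Nd br p y : lsubst (br^~ y) \l p = br (at_Nd p) y.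
Proof.
have [BD B0 BZ BX] := lbr_semilinl br y.
have BN u : br (- 'X *: u) y = 'X *: br u y.
  have -> : - 'X = (-1)%:P * 'X :> {poly C} by rewrite polyCN mulN1r.
  by rewrite -scalerA BZ BX scalerA !polyCN mulrNN mul1r.
rewrite /at_Nd /lsubst (big_morph (br^~ y) BD B0); apply: eq_bigr => n _.
move: p@_n => u; elim: n => [|n IH]; first by rewrite !expr0 !scale1r.
by rewrite [in LHS]exprS -[LHS]scalerA IH [in RHS]exprS -[X in _ = br X _]scalerA BN.
Qed.

End Derivations.

(** * Coordinates along the generators *)

Section Coordinates.
Set Implicit Arguments.
Unset Strict Implicit.
Local Open Scope ring_scope.
Local Open Scope lambda_scope.

Context {C : numFieldType}.
Implicit Types (k m : int * csv_gen) (x y w : csv C) (p q : lpoly (csv C)).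
Notation i2 := (fun c : C => c%:P%:P : {poly {poly C}}).

(** Valued in the regular module, so that substitution applies to it. *)
Definition cst_coor k x : {poly {poly C}}^o := (x@_k)%:P.

Lemma cst_coor_semilin k : semilin i2 \d (cst_coor k).
Proof.
split=> [x y||c x|x]; rewrite /cst_coor.
- by rewrite mcoeffD polyCD.
- by rewrite mcoeff0.
- by rewrite mcoeffZ polyCM.
- by rewrite mcoeffZ polyCM.
Qed.

Definition coor k p : {poly {poly C}} := lsubst (cst_coor k) \l p.

Lemma coorD k p q : coor k (p + q) = coor k p + coor k q.
Proof. by have [fD f0 _ _] := cst_coor_semilin k; exact: (lsubstD \l p q fD f0). Qed.

Lemma coor0 k : coor k 0 = 0.
Proof. exact: (lsubst0 (cst_coor k) \l). Qed.

Lemma coorZ k (r : {poly {poly C}}) p : coor k (r *: p) = r * coor k p.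
Proof.
have [fD f0 _ _] := cst_coor_semilin k.
elim/poly_ind: r p => [|r c IH] p; first by rewrite scale0r coor0 mul0r.
rewrite scalerDl coorD -scalerA IH mulrDl -mulrA; congr (_ * _ + _).
  exact: (lsubstX _ _ fD f0).
apply: (lsubstC (d := c%:P) _ _ fD f0) => v.
by rewrite /cst_coor mcoeffZ polyCM.
Qed.

Lemma coor_sum k (I : Type) (r : seq I) (F : I -> lpoly (csv C)) :
  coor k (\sum_(i <- r) F i) = \sum_(i <- r) coor k (F i).
Proof. exact: (big_morph (coor k) (coorD k) (coor0 k)). Qed.

Lemma coor_lconst k x : coor k (lconst x) = (x@_k)%:P.
Proof. by have [_ f0 _ _] := cst_coor_semilin k; exact: (lsubst_const \l x f0). Qed.

Lemma coef_coor k p n : (coor k p)`_n = p@_n@_k.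
Proof.
elim/(@lpoly_ind {poly C} (csv C)): p => [|u v IHu IHv|v i].
- by rewrite coor0 coef0 !mcoeff0.
- by rewrite coorD coefD IHu IHv !mcoeffD.
have [_ f0 _ _] := cst_coor_semilin k.
rewrite /coor lsubstU // mcoeffU [_ *: _]mulrC coefCM coefXn eq_sym.
by case: eqP => _; rewrite ?mulr1 ?mulr0 ?mulr1n ?mulr0n ?mcoeff0.
Qed.

Lemma eq_coor p q : (forall k, coor k p = coor k q) -> p = q.
Proof.
by move=> E; apply/malgP => n; apply/malgP => k; rewrite -!coef_coor E.
Qed.

Lemma semilin_coor k t (T : csv C -> lpoly (csv C)) : semilin i2 t T ->
  semilin i2 t (fun x => coor k (T x) : {poly {poly C}}^o).
Proof.
case=> TD T0 TZ TX; split=> [x y||c x|x].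
- by rewrite TD coorD.
- by rewrite T0 coor0.
- by rewrite TZ coorZ.
- by rewrite TX coorZ.
Qed.

(** The equality test of [csv_gen] goes through [inord] and does not compute. *)
Lemma csv_gen_eqE (g h : csv_gen) :
  (g == h) = match g, h with GL, GL | GM, GM | GY, GY => true | _, _ => false end.
Proof. by case: g h => [] []; apply/eqP. Qed.

Context (a b : C).
Notation br := (csv_br a b).

(** For given [g] and [h] at most one type [s] contributes with a nonzero
    coefficient; the sum over all three keeps the formula uniform. *)
Lemma coor_br x n h j g : coor (n, h) (br x << (j, g) >>) =
  \sum_(s <- [:: GL; GM; GY])
     (csv_tgt s g == h)%:R * (at_Nl x@_(n - j, s) * csv_lin i2 (csv_cf a b s g) \d \l).
Proof.
pose T' x : {poly {poly C}}^o := \sum_(s <- [:: GL; GM; GY])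
     (csv_tgt s g == h)%:R * (at_Nl x@_(n - j, s) * csv_lin i2 (csv_cf a b s g) \d \l).
have sT' : semilin i2 (- \l) T'.
  split=> [u v||c u|u]; rewrite /T'.
  - by rewrite -big_split; apply: eq_bigr => s _; rewrite mcoeffD rmorphD mulrDl mulrDr.
  - by rewrite big1 // => s _; rewrite mcoeff0 rmorph0 mul0r mulr0.
  - rewrite scaler_sumr; apply: eq_bigr => s _; rewrite mcoeffZ rmorphM /= at_NlC.
    by rewrite /GRing.scale /=; ring.
  - rewrite scaler_sumr; apply: eq_bigr => s _; rewrite mcoeffZ rmorphM /= at_NlX.
    by rewrite /GRing.scale /=; ring.
apply: (semilin_ext (semilin_coor (n, h) (csv_br_l a b << (j, g) >>)) sT').
case=> i s; rewrite csv_br_gen csv_gen_brE coorZ coor_lconst /T' /=.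
rewrite mcoeffU xpair_eqE !big_cons big_nil !mcoeffU !xpair_eqE.
have -> : (i == n - j) = (i + j == n) by rewrite eq_sym subr_eq eq_sym.
case: (i + j == n); rewrite ?(rmorph0, mulr0, mul0r, addr0) //=.
rewrite [s == GL]csv_gen_eqE [s == GM]csv_gen_eqE [s == GY]csv_gen_eqE.
case: s; rewrite ?(rmorph0, rmorph1, mulr0, mul0r, mul1r, addr0, add0r) /=;
  by case: (_ == h); rewrite ?(mulr1, mulr0, mul1r, mul0r).
Qed.

End Coordinates.

(** * The outer derivations *)

Section Outer.
Set Implicit Arguments.
Unset Strict Implicit.
Local Open Scope ring_scope.
Local Open Scope lambda_scope.

Context {C : numFieldType}.
Notation i2 := (fun c : C => c%:P%:P : {poly {poly C}}).
Notation i3 := (fun c : C => c%:P%:P%:P : {poly {poly {poly C}}}).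
Implicit Types (v : {malg C[int]}).

Lemma Dvec_semilin v : semilin i2 (\d + \l) (Dvec v).
Proof. exact: (semilin_eqi (@at_dlC C) (@at_dlX C) (csv_extend_semilin _ _)). Qed.

Lemma Dvec_genE v k :
  Dvec v << k >> = \sum_(c <- msupp v)
    ((if k.2 is GL then v@_c else 0)%:P%:P) *: lconst << (k.1 + c, GM) >>.
Proof.
rewrite /Dvec csv_extend_gen; case: k => i [] //=.
  by rewrite big1 // => c _; rewrite !polyC0 scale0r.
by rewrite big1 // => c _; rewrite !polyC0 scale0r.
Qed.

Lemma coor_Dvec v m k : coor m (Dvec v << k >>) =
  (if (k.2, m.2) is (GL, GM) then v@_(m.1 - k.1) else 0)%:P%:P.
Proof.
case: k m => [j g] [n h] /=; rewrite Dvec_genE coor_sum /=.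
case: g => /=; last 2 first.
- by rewrite !polyC0 big1 // => c _; rewrite scale0r coor0.
- by rewrite !polyC0 big1 // => c _; rewrite scale0r coor0.
have [->|hM] := eqVneq h GM; last first.
  rewrite big1 => [|c _]; first by case: h hM => //; rewrite ?eqxx.
  rewrite coorZ coor_lconst mcoeffU xpair_eqE [GM == h]eq_sym (negbTE hM) andbF.
  by rewrite polyC0 mulr0.
have -> : v@_(n - j) = \sum_(c <- msupp v) v@_c *+ (j + c == n).
  rewrite {1}(monalgE v) raddf_sum; apply: eq_bigr => c _.
  by rewrite /= mcoeffU eq_sym subr_eq addrC eq_sym.
rewrite !rmorph_sum; apply: eq_bigr => c _ /=.
rewrite coorZ coor_lconst mcoeffU xpair_eqE eqxx andbT.
by case: (_ == n); rewrite ?mulr1n ?mulr0n ?polyC0 ?polyC1 ?mulr1 ?mulr0.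
Qed.

(** The derivation rule for the outer map on a pair of generators of types [g] and
    [h], as an identity between the structure polynomials: only two generators of
    type L give nonzero terms, and there it reads
    D + L + 2M = (L + M - b) + (D + M + b). *)
Lemma outer_poly b g h c (B : comNzRingType) (i : {rmorphism C -> B}) (D L M : B) :
  csv_lin i (csv_cf 1 b g h) (D + L) M * i (if csv_tgt g h is GL then c else 0) =
  i (if g is GL then c else 0) * csv_lin i (csv_cf 1 b GM h) D (L + M)
  + i (if h is GL then c else 0) * csv_lin i (csv_cf 1 b g GM) D M.
Proof.
rewrite /csv_cf /csv_lin.
case: g h => [] [] /=; rewrite ?(rmorph0, mul0r, mulr0, addr0, add0r) //; ring.
Qed.

(** Both sides of the derivation rule are semilinear in each argument with the same
    factor, so it suffices to compare them on generators. *)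
Lemma Dvec_conformal_derivation b v : conformal_derivation (CSV 1 b) (Dvec v).
Proof.
have sD := Dvec_semilin v; have sl y := lbr_semilinl (CSV 1 b) y.
have sr x := lbr_semilinr (CSV 1 b) x.
have s2l t y := lsubst2_semilinl (CSV 1 b) t y.
have s2r t x := lsubst2_semilinr (CSV 1 b) t x.
have sD3 := semilin_lconst sD.
split; [exact: semilin_linear sD|by case: sD|move=> x y].
pose F1 x y := lsubst (fun u => lconst (Dvec v u)) \m2 (CSV 1 b x y).
pose F2 x y := lsubst (fun u => lsubst2 (\l2 + \m2) (CSV 1 b u y)) \l2 (Dvec v x).
pose F3 x y := lsubst (fun u => lsubst2 \m2 (CSV 1 b x u)) \l2 (Dvec v y).
rewrite -[LHS]/(F1 x y) -[RHS]/(F2 x y + F3 x y).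
have F1l : semilin i3 (- \m2) (F1^~ y) by exact: (semilin_lsubst_Nl _ sD3 (sl y)).
have F23l : semilin i3 (- \m2) (fun x => F2 x y + F3 x y).
  apply: semilinD; last by apply: semilin_lsubst_fun => u; exact: s2l.
  by apply: semilin_eqt (semilin_lsubst_dl _ (s2l _ _) sD); ring.
apply: (semilin_ext F1l F23l) => {F1l F23l x} k.
have F1r : semilin i3 ((\d)%:P + \l2 + \m2) (F1 << k >>).
  by apply: semilin_eqt (semilin_lsubst_dl _ sD3 (sr _)); rewrite polyCD.
have F23r : semilin i3 ((\d)%:P + \l2 + \m2) (fun y => F2 << k >> y + F3 << k >> y).
  apply: semilinD.
    by apply: semilin_lsubst_fun => u; apply: semilin_eqt (s2r _ _); rewrite addrA.
  by apply: semilin_eqt (semilin_lsubst_dl _ (s2r _ _) sD); ring.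
apply: (semilin_ext F1r F23r) => {F1r F23r y} l.
rewrite /F1 /F2 /F3 {F1 F2 F3}.
have E t p q : lsubst2 t (CSV 1 b << p >> << q >>) =
    csv_lin i3 (csv_cf 1 b p.2 q.2) (\d)%:P t
      *: lconst (lconst << (p.1 + q.1, csv_tgt p.2 q.2) >>).
  have cc := semilin_lconst (semilin_lconst (semilin_id (csv C))).
  rewrite /lsubst2 /= csv_br_gen csv_gen_brE (lsubst_lin _ _ _ cc).
  by rewrite lsubst_const ?lconst0.
have DE (f : csv C -> lpoly (lpoly (csv C))) t r q : semilin i3 r f ->
    lsubst f t (Dvec v << q >>) = \sum_(c <- msupp v)
      ((if q.2 is GL then v@_c else 0)%:P%:P%:P) *: f << (q.1 + c, GM) >>.
  move=> sf; have [fD f0 _ _] := sf; rewrite Dvec_genE.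
  rewrite (big_morph (lsubst f t) (fun p q => lsubstD t p q fD f0) (lsubst0 f t)).
  by apply: eq_bigr => c _; rewrite (lsubstc _ _ _ sf) lsubst_const.
have R1 := DE (fun u => lsubst2 (\l2 + \m2) (CSV 1 b u << l >>)) \l2 _ k (s2l _ _).
have R2 := DE (fun u => lsubst2 \m2 (CSV 1 b << k >> u)) \l2 _ l (s2r _ _).
refine (etrans _ (esym (f_equal2 (fun p q : lpoly (lpoly (csv C)) => p + q) R1 R2))).
rewrite -big_split {R1 R2 DE} /=.
rewrite csv_br_gen csv_gen_brE (lsubst_lin _ _ _ sD3) lsubst_const; last first.
  by have [_ z _ _] := sD3.
rewrite Dvec_genE (big_morph (@lconst _ _) (@lconstD _ _) (@lconst0 _ _)) scaler_sumr.
apply: eq_bigr => c _ /=.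
rewrite !E lconstZ !scalerA /=.
have -> : k.1 + c + l.1 = k.1 + l.1 + c by rewrite addrAC.
rewrite addrA.
have -> : csv_tgt k.2 GM = GM by case: (k.2).
rewrite -scalerDl; congr (_ *: _).
rewrite polyCD.
exact: (outer_poly b k.2 l.2 v@_c (polyC \o (polyC \o polyC)) (\d)%:P \l2 \m2).
Qed.

End Outer.

(** * The weight equation *)

Section Weights.
Set Implicit Arguments.
Unset Strict Implicit.
Local Open Scope ring_scope.
Local Open Scope lambda_scope.

Context {C : numFieldType} (a b : C).
Notation i2 := (fun c : C => c%:P%:P : {poly {poly C}}).
Notation br := (csv_br a b).
Implicit Types (k m : int * csv_gen) (x z : csv C) (D : csv C -> lpoly (csv C)).

(** The constant [weight g] is the one for which the zero mode of [L_0 mu -] acts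
    by d + [weight g] on the generators of type [g]. *)
Definition weight (g : csv_gen) : C :=
  match g with GL => 0 | GM => b | GY => b / 2 end.

Lemma br_L0_at0 k x :
  (br (csvL 0) x)@_0%N@_k = ('X + (weight k.2)%:P) * x@_k.
Proof.
pose T x : {poly C}^o := (br (csvL 0) x)@_0%N@_k.
pose T' x : {poly C}^o := ('X + (weight k.2)%:P) * x@_k.
have [BD B0 BZ BX] := csv_br_r a b (csvL 0).
have sT : semilin (@polyC C) 'X T.
  split=> [u v||c u|u]; rewrite /T.
  - by rewrite BD !mcoeffD.
  - by rewrite B0 !mcoeff0.
  - by rewrite BZ -!coef_coor coorZ coef0M coefC.
  - by rewrite BX -!coef_coor coorZ coef0M coefD coefC coefX addr0.
have sT' : semilin (@polyC C) 'X T'.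
  split=> [u v||c u|u]; rewrite /T' ?mcoeffD ?mcoeff0 ?mcoeffZ.
  - exact: mulrDr.
  - exact: mulr0.
  - exact: mulrCA.
  - exact: mulrCA.
apply: (semilin_ext sT sT') => l; rewrite /T /T' -coef_coor csv_br_gen csv_gen_brE.
rewrite coorZ coor_lconst coef0M coefC /= add0r.
have -> : (l.1, csv_tgt GL l.2) = l by case: l => i [].
have [->|lk] := eqVneq l k; last by rewrite mcoeffU (negbTE lk) !mulr0.
rewrite mcoeffUU !mulr1 /csv_lin !coefD !coefCM coefX !coefC /= mulr0 addr0.
by case: (k.2); rewrite mul1r.
Qed.

Lemma coor_map_br_L0 m (p : lpoly (csv C)) :
  coor m (lsubst (fun u => lconst (br (csvL 0) u)@_0%N) \l p) =
  (\d + (weight m.2)%:P%:P) * coor m p.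
Proof.
rewrite {1}/lsubst coor_sum [in RHS]/coor /lsubst big_distrr; apply: eq_bigr => n _ /=.
rewrite coorZ coor_lconst br_L0_at0 polyCM polyCD mulrCA; congr (_ * _).
Qed.

(** The zero mode and d both are derivations of the bracket, hence so is the
    diagonal map given by the weights. *)
Lemma weight_tgt s g : csv_cf a b s g <> 0 -> weight (csv_tgt s g) = weight s + weight g.
Proof. by case: s g => [] [] //= _; rewrite ?addr0 ?add0r //; field. Qed.

(** The zero mode applied before [D] contributes d + lambda + [weight k.2], applied
    after it d + [weight m.2]; the variable d cancels. *)
Lemma derivation_weight D k m : conformal_derivation (CSV a b) D ->
  (\l + (weight k.2 - weight m.2)%:P%:P) * coor m (D << k >>) =
  coor m (br (at_Nd (D (csvL 0))) << k >>).
Proof.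
move=> dD; have [DD D0 DZ DX] := conformal_derivation_semilin dD.
have /= E := conformal_derivation_at0 (csvL 0) << k >> dD.
have E0 : (br (csvL 0) << k >>)@_0%N = 'X *: << k >> + (weight k.2)%:P *: << k >>.
  rewrite -scalerDl; apply/malgP => l; rewrite br_L0_at0 [RHS]mcoeffZ mcoeffU.
  by have [->|lk] := eqVneq k l; rewrite ?mulr0.
have ED : D (br (csvL 0) << k >>)@_0%N = (\d + \l + (weight k.2)%:P%:P) *: D << k >>.
  by rewrite E0 DD scalerDl; congr (_ + _); [exact: DX|exact: DZ].
move: E; rewrite ED (lbr_at_Nd (CSV a b)) /= => /(congr1 (coor m)).
rewrite coorD coorZ coor_map_br_L0 => E.
apply: (addIr ((\d + (weight m.2)%:P%:P) * coor m (D << k >>))); rewrite -E.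
by rewrite !polyCB; ring.
Qed.

Lemma at_Nl_shift (c : C) (p : {poly C}) :
  at_Nl (- ('X + c%:P) * p) = (\l - c%:P%:P) * at_Nl p.
Proof.
rewrite /at_Nl (rmorphM (map_poly polyC)) comp_polyM; congr (_ * _).
rewrite (rmorphN (map_poly polyC)) (rmorphD (map_poly polyC)).
rewrite /= map_polyX map_polyC /= (raddfN (comp_poly _)) /=.
by rewrite comp_polyD comp_polyX comp_polyC opprD opprK.
Qed.

(** The equation of [derivation_weight] for ad x, where w = -(d + weight) x. *)
Lemma br_weight x z k m :
  (forall l, z@_l = - ('X + (weight l.2)%:P) * x@_l) ->
  (\l + (weight k.2 - weight m.2)%:P%:P) * coor m (br x << k >>) = coor m (br z << k >>).
Proof.
case: k m => [j g] [n h] E; rewrite !coor_br big_distrr; apply: eq_bigr => s _ /=.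
case: eqP => [<-|_]; last by rewrite !mul0r mulr0.
have [->|/eqP/weight_tgt ->] := eqVneq (csv_cf a b s g) 0.
  by rewrite /csv_lin /= !polyC0 !(mul0r, add0r, mulr0).
have -> : at_Nl z@_(n - j, s) = (\l - (weight s)%:P%:P) * at_Nl x@_(n - j, s).
  by rewrite E at_Nl_shift.
rewrite !polyCB !polyCD; ring.
Qed.

(** The equation of [derivation_weight] for an outer derivation, where w is the
    element with constant coordinates [v] along the M_c.  The hypothesis says
    that a = 1 or v = 0, in a form in which it follows from [residue_M]. *)
Lemma Dvec_weight v z k m : (forall c, v@_c * (a - 1) = 0) ->
  (forall l, z@_l = (if l.2 is GM then v@_l.1 else 0)%:P) ->
  (\l + (weight k.2 - weight m.2)%:P%:P) * coor m (Dvec v << k >>) = coor m (br z << k >>).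
Proof.
case: k m => [j g] [n h] va E; rewrite coor_br coor_Dvec /= !big_cons big_nil !E /=.
rewrite !polyC0 !rmorph0 !(mul0r, mulr0, add0r, addr0) at_NlC.
have := va (n - j); move: v@_(n - j) => c /(congr1 (fun t => t%:P%:P : {poly {poly C}})).
rewrite !polyCM !polyCB !polyC1 !polyC0 => {}va.
case: g => /=; last 2 first.
- by rewrite /csv_lin /= !polyC0 !(mul0r, add0r, mulr0).
- by rewrite /csv_lin /= !polyC0 !(mul0r, add0r, mulr0).
rewrite csv_gen_eqE; case: h => /=; rewrite ?polyC0 ?mulr0 ?mul0r // mul1r.
rewrite /csv_lin /= sub0r !polyCN polyCB polyC1.
transitivity (c%:P%:P * (\l - b%:P%:P) + c%:P%:P * (a%:P%:P - 1) * (\d + \l)); last by ring.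
by rewrite va mul0r addr0 mulrC.
Qed.

Lemma horner_at_Nl (p : {poly C}) c : (at_Nl p).[c%:P] = p.[- c]%:P.
Proof. by rewrite /at_Nl horner_comp hornerN hornerX -polyCN horner_map. Qed.

Section Residues.
Context (D : csv C -> lpoly (csv C)) (dD : conformal_derivation (CSV a b) D).
Notation w := (at_Nd (D (csvL 0))).

(** The factor lambda + weight k.2 - weight m.2 vanishes at lambda = [c]. *)
Lemma horner_br_residue k m (c := weight m.2 - weight k.2) :
  (coor m (br w << k >>)).[c%:P] = 0.
Proof.
rewrite -(derivation_weight k m dD) hornerM hornerD hornerX hornerC -polyCD.
by rewrite /c -opprB addNr polyC0 mul0r.
Qed.

(** At lambda = 0 the bracket [L_n lambda L_0] is d L_n, which is nonzero. *)
Lemma residue_L n : (w@_(n, GL)).[0] = 0.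
Proof.
have := horner_br_residue (0, GL) (n, GL); rewrite coor_br !big_cons big_nil !csv_gen_eqE /=.
rewrite !mul0r !addr0 mul1r !subr0 hornerM horner_at_Nl oppr0 /csv_lin /=.
rewrite !polyC0 addr0 hornerD !hornerCM hornerX !hornerC mulr0 addr0 mul1r => /eqP.
by rewrite mulf_eq0 polyX_eq0 orbF polyC_eq0 => /eqP.
Qed.

(** At lambda = b the bracket [M_n lambda L_0] is (a - 1) (d + b) M_n. *)
Lemma residue_M n : (w@_(n, GM)).[- b] * (a - 1) = 0.
Proof.
have := horner_br_residue (0, GL) (n, GM); rewrite coor_br !big_cons big_nil !csv_gen_eqE /=.
rewrite !mul0r !add0r !addr0 mul1r !subr0 hornerM horner_at_Nl /csv_lin /=.
rewrite !hornerD !hornerCM hornerX !hornerC.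
have -> : (a - 1)%:P * 'X + a%:P * b%:P + (- b)%:P = (a - 1)%:P * ('X + b%:P) :> {poly C}.
  by rewrite polyCN polyCB; ring.
rewrite mulrA -polyCM => /eqP.
by rewrite mulf_eq0 (negbTE (monic_neq0 (monicXaddC _))) orbF polyC_eq0 => /eqP.
Qed.

(** Here [L_0] would not do: at lambda = b/2 the bracket [Y_n lambda L_0] has the
    factor a, while [Y_n lambda Y_0] is (d + b) M_n for every a. *)
Lemma residue_Y n : (w@_(n, GY)).[- (b / 2)] = 0.
Proof.
have := horner_br_residue (0, GY) (n, GM); rewrite coor_br !big_cons big_nil !csv_gen_eqE /=.
have -> : b - b / 2 = b / 2 by field.
rewrite /csv_lin /= !polyC0 !(mul0r, mulr0, add0r, addr0) mul1r ?subr0 hornerM horner_at_Nl.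
rewrite !hornerD !hornerCM hornerX !hornerC -polyCM.
have -> : 2 * (b / 2) = b by field.
rewrite mul1r => /eqP.
by rewrite mulf_eq0 (negbTE (monic_neq0 (monicXaddC _))) orbF polyC_eq0 => /eqP.
Qed.

End Residues.
End Weights.

(** * The decomposition *)

Section Decomposition.
Set Implicit Arguments.
Unset Strict Implicit.
Local Open Scope ring_scope.
Local Open Scope lambda_scope.
Context {C : numFieldType} (a b : C).
Notation br := (csv_br a b).
Notation weight := (weight b).

Lemma Dvec0 : Dvec (0 : {malg C[int]}) = \0.
Proof.
apply/funext => x; rewrite /Dvec /csv_extend big1 //= => -[i g] _.
by case: g => /=; rewrite ?msupp0 ?big_seq_fset0 scaler0.
Qed.

(** Subtract from w = [at_Nd (D (csvL 0))] the multiple of d + weight that belongs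
    to an inner derivation; what is left, [z], belongs to an outer one.  Since the
    three weight equations have the same nonzero factor, [D] and the sum agree on
    generators. *)
Lemma CDer_decomposition D : conformal_derivation (CSV a b) D ->
  exists x v, (forall c, v@_c * (a - 1) = 0) /\ D = br x \+ Dvec v.
Proof.
move=> dD.
pose w : csv C := at_Nd (D (csvL 0)).
(* Division of w_k by d + weight k.2, with quotient q k and constant remainder r k. *)
pose q k : {poly C} := w@_k %/ ('X - (- weight k.2)%:P).
pose r k : C := (w@_k).[- weight k.2].
have Er k : k \notin msupp w -> r k = 0.
  by move=> kw; rewrite /r mcoeff_outdom // horner0.
pose x : csv C := [malg k in msupp w => - q k].
have xE k : x@_k = - q k.
  rewrite mcoeffE; case: ifPn => // kw.
  by rewrite /q mcoeff_outdom // div0p oppr0.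
pose v : {malg C[int]} := [malg c in [fset k.1 | k in msupp w]%fset => r (c, GM)].
have vE c : v@_c = r (c, GM).
  rewrite mcoeffE; case: ifPn => // cw; rewrite Er //; apply: contra cw => kw.
  by apply/imfsetP; exists (c, GM).
pose z : csv C := [malg k in msupp w => (r k)%:P].
have zE k : z@_k = (r k)%:P.
  by rewrite mcoeffE; case: ifPn => // kw; rewrite Er.
have va c : v@_c * (a - 1) = 0 by rewrite vE; exact: (residue_M dD c).
have zv k : z@_k = (if k.2 is GM then v@_k.1 else 0)%:P.
  rewrite zE; congr (_%:P); case: k => c [] /=.
  - by rewrite /r /= oppr0; exact: (residue_L dD c).
  - by rewrite vE.
  - exact: (residue_Y dD c).
have wxz k : (w - z)@_k = - ('X + (weight k.2)%:P) * x@_k.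
  rewrite mcoeffB zE xE mulrNN {1}(divp_eq w@_k ('X - (- weight k.2)%:P)) modp_XsubC addrK.
  by rewrite mulrC -/(q k) polyCN opprK.
exists x, v; split=> //; apply/funext.
have sR := semilinD (csv_br_r a b x) (Dvec_semilin v).
apply: (semilin_ext (conformal_derivation_semilin dD) sR) => k.
apply: eq_coor => m.
have nz : \l + (weight k.2 - weight m.2)%:P%:P != 0 :> {poly {poly C}}.
  by apply/monic_neq0/monicXaddC.
apply: (mulfI nz); rewrite coorD mulrDr (derivation_weight k m dD).
rewrite (br_weight a k m wxz) (Dvec_weight b k m va zv) -coorD.
have [BD _ _ _] := csv_br_l a b << k >>.
by rewrite -BD subrK.
Qed.

(** When a = 1 the bracket [M_i lambda L_0] has the factor lambda - b, so the
    coordinates of [br x (csvL 0)] along the M_c vanish at lambda = b, while those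
    of [Dvec v (csvL 0)] are the constants v_c. *)
Lemma inner_outer_disjoint x v : a = 1 -> br x = Dvec v -> v = 0.
Proof.
move=> a1 E; apply/malgP => c; rewrite mcoeff0.
move: (congr1 (fun f => coor (c, GM) (f << (0, GL) >>)) E) => /=.
rewrite coor_br coor_Dvec !big_cons big_nil !csv_gen_eqE /= !mul0r mul1r add0r !addr0 ?subr0.
move=> /(congr1 (fun p : {poly {poly C}} => p.[b%:P])).
rewrite hornerM hornerC /csv_lin /= !hornerD !hornerCM hornerX !hornerC.
rewrite a1 subrr !polyC0 mul0r add0r polyC1 mul1r polyCN subrr mulr0.
by move/esym/eqP; rewrite polyC_eq0 => /eqP.
Qed.

Local Open Scope classical_set_scope.
Theorem CDer_CSV : direct_sum (CDer (CSV a b)) (CInn (CSV a b))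
    (if a == 1 then Cinfty C else [set \0]).
Proof.
have Oder D : (if a == 1 then Cinfty C else [set \0]) D -> conformal_derivation (CSV a b) D.
  case: eqP => [->|_]; first by case=> v _ <-; exact: Dvec_conformal_derivation.
  move=> ->; rewrite (_ : \0 = CSV a b 0); first exact: inner_conformal_derivation.
  by apply/funext => y; have [_ B0 _ _] := csv_br_l a b y; rewrite /= B0.
split; apply/seteqP; split=> D.
- move=> /CDer_decomposition[x [v [va ->]]].
  exists (br x); first by exists x.
  exists (Dvec v) => //; case: eqP => [_|a1]; first by exists v.
  rewrite (_ : v = 0) ?Dvec0 //; apply/malgP => c; rewrite mcoeff0.
  by have /eqP := va c; rewrite mulf_eq0 subr_eq0 (introF eqP a1) orbF => /eqP.
- case=> _ [x _ <-] [D' D'O <-].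
  by apply: conformal_derivationD; [exact: inner_conformal_derivation|exact: Oder].
- case=> -[x _ <-]; case: eqP => [a1 [v _ vx]|//].
  have v0 := inner_outer_disjoint a1 (esym vx).
  by rewrite -[CSV a b x]vx v0 Dvec0.
- move=> ->; split.
    exists 0 => //; apply/funext => y.
    by have [_ B0 _ _] := csv_br_l a b y; rewrite /= B0.
  by case: eqP => // _; exists 0 => //; exact: Dvec0.
Qed.

End Decomposition.

Theorem theorem3p2 (R : realType) (a b : complex R) :
  direct_sum (CDer (CSV a b)) (CInn (CSV a b))
    (if (a == 1)%R then Cinfty (complex R) else [set (\0)%R])%classic.
Proof. exact: CDer_CSV. Qed.
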